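(* Let $n,N\ge 1$, let $H_1,\dots,H_N\in\mathbb{R}^{n\times n}$ be given matrices, let $\omega>0$, and let $\mu>0$ be a given scalar. Suppose there exist symmetric matrices $X,M\in\mathbb{R}^{n\times n}$ and a (full, not necessarily symmetric) matrix $L\in\mathbb{R}^{n\times n}$ such that $$X>0,\qquad M>0,$$ $$\begin{bmatrix} H_iL+L^\top H_i^\top+\frac{\mu}{4}I+M & L^\top H_i^\top\\ H_iL & -\mu I\end{bmatrix}<0\qquad\text{for all } i=1,\dots,N.$$ Let $K=LX^{-1}$. Then for every $\alpha\in\Lambda$ the origin of the average closed-loop system $$\dot{\hat G}_{\mathrm{av}}(\tau)=\frac1\omega H(\alpha)K\,\frac{\hat G_{\mathrm{av}}(\tau)}{\|\hat G_{\mathrm{av}}(\tau)\|},\qquad H(\alpha)=\sum_{i=1}^N\alpha_iH_i,$$ is finite-time stable: it is Lyapunov stable and every solution, from any initial condition $\hat G_{\mathrm{av}}(0)\in\mathbb{R}^n$, reaches the origin in finite time and remains there.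
   Context: For a symmetric matrix $A$, $A>0$ (resp. $A<0$) means positive (resp. negative) definite; $\|\cdot\|$ is the Euclidean norm. $\Lambda=\{\alpha\in\mathbb{R}^N:\sum_{i=1}^N\alpha_i=1,\ \alpha_i\ge0,\ i=1,\dots,N\}$ is the unit simplex; $\alpha$ is an unknown constant parameter, so $H(\alpha)$ is an unknown constant matrix in the convex hull of the known vertices $H_1,\dots,H_N$. The state is $\hat G_{\mathrm{av}}(\tau)\in\mathbb{R}^n$ and the dot denotes $d/d\tau$. The right-hand side is discontinuous at the origin; solutions are understood in the sense of Filippov. *)

(* Defs.v *)
From HB Require Import structures.
From mathcomp Require Import all_boot all_order all_algebra.
From mathcomp Require Import all_classical all_reals all_analysis.

Set Implicit Arguments.
Unset Strict Implicit.
Unset Printing Implicit Defensive.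

Import Order.TTheory GRing.Theory Num.Theory.
Import numFieldNormedType.Exports.

Local Open Scope classical_set_scope.
Local Open Scope ring_scope.

Definition posdef (R : realType) (m : nat) (A : 'M[R]_m) : Prop :=
  A^T = A /\ forall v : 'cV[R]_m, v != 0 -> 0 < (v^T *m A *m v) 0 0.

Definition negdef (R : realType) (m : nat) (A : 'M[R]_m) : Prop :=
  A^T = A /\ forall v : 'cV[R]_m, v != 0 -> (v^T *m A *m v) 0 0 < 0.

(* The library norm of a matrix is the sup norm, hence this definition. The
   topology and the derivatives below are the library ones: all norms on R^n
   are equivalent. *)
Definition enorm (R : realType) (n : nat) (x : 'cV[R]_n) : R :=
  Num.sqrt (\sum_(i < n) x i 0 ^+ 2).

Definition eball (R : realType) (n : nat) (x : 'cV[R]_n) (r : R) :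
    set 'cV[R]_n :=
  [set y | enorm (y - x) < r].

Definition box (R : realType) (n : nat) (a b : 'cV[R]_n) : set 'cV[R]_n :=
  [set y | forall i, a i 0 <= y i 0 <= b i 0].

(* Null sets of n-dimensional Lebesgue measure: for every eps > 0 the set is
   covered by countably many boxes of total volume at most eps. *)
Definition lebesgue_null (R : realType) (n : nat) (S : set 'cV[R]_n) : Prop :=
  forall eps : R, 0 < eps ->
  exists a b : nat -> 'cV[R]_n,
    [/\ forall k i, a k i 0 <= b k i 0,
        S `<=` \bigcup_k box (a k) (b k)
      & (\sum_(0 <= k <oo) (\prod_(i < n) (b k i 0 - a k i 0))%:E <= eps%:E)%E].

Definition closed_convex_hull (R : realType) (n : nat) (S : set 'cV[R]_n) :
    set 'cV[R]_n :=
  smallest [set C : set 'cV[R]_n | closed C /\ @convex_set R 'cV[R]_n C] S.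

(* Filippov regularization: the intersection over all delta > 0 and all null
   sets N of the closed convex hull of f (B (x, delta) \ N). *)
Definition filippov (R : realType) (n : nat) (f : 'cV[R]_n -> 'cV[R]_n)
    (x : 'cV[R]_n) : set 'cV[R]_n :=
  [set v | forall (delta : R) (S : set 'cV[R]_n),
     0 < delta -> lebesgue_null S ->
     closed_convex_hull (f @` (eball x delta `\` S)) v].

Definition abs_continuous_on (R : realType) (n : nat) (a b : R)
    (x : R -> 'cV[R]_n) : Prop :=
  forall eps : R, 0 < eps -> exists delta : R, 0 < delta /\
  forall (m : nat) (s t : 'I_m -> R),
    (forall k, [&& a <= s k, s k <= t k & t k <= b]) ->
    trivIset [set: 'I_m] (fun k => [set u : R | s k < u < t k]) ->
    \sum_(k < m) (t k - s k) < delta ->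
    \sum_(k < m) enorm (x (t k) - x (s k)) < eps.

(* Filippov solution of x' = f(x) on [0, T), with T possibly infinite; the
   values of x outside [0, T) are irrelevant. *)
Definition filippov_solution (R : realType) (n : nat)
    (f : 'cV[R]_n -> 'cV[R]_n) (T : \bar R) (x : R -> 'cV[R]_n) : Prop :=
  [/\ (0 < T)%E,
      forall b : R, 0 <= b -> (b%:E < T)%E -> abs_continuous_on 0 b x
    & {ae @lebesgue_measure R, forall t : R, 0 <= t -> (t%:E < T)%E ->
        derivable x t 1 /\ filippov f (x t) (derive1 x t)}].

Definition maximal_filippov_solution (R : realType) (n : nat)
    (f : 'cV[R]_n -> 'cV[R]_n) (T : \bar R) (x : R -> 'cV[R]_n) : Prop :=
  filippov_solution f T x /\
  forall (T' : \bar R) (y : R -> 'cV[R]_n),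
    filippov_solution f T' y -> (T <= T')%E ->
    (forall t : R, 0 <= t -> (t%:E < T)%E -> y t = x t) ->
    T' = T.

Definition lyapunov_stable (R : realType) (n : nat)
    (f : 'cV[R]_n -> 'cV[R]_n) : Prop :=
  forall eps : R, 0 < eps -> exists delta : R, 0 < delta /\
  forall (T : \bar R) (x : R -> 'cV[R]_n),
    filippov_solution f T x -> enorm (x 0) < delta ->
    forall t : R, 0 <= t -> (t%:E < T)%E -> enorm (x t) < eps.

(* Maximality only excludes solutions that are stopped artificially before
   they reach the origin. *)
Definition finite_time_convergent (R : realType) (n : nat)
    (f : 'cV[R]_n -> 'cV[R]_n) : Prop :=
  forall (T : \bar R) (x : R -> 'cV[R]_n),
    maximal_filippov_solution f T x ->
    T = +oo%E /\
    exists ts : R, 0 <= ts /\ forall t : R, ts <= t -> x t = 0.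

Definition finite_time_stable (R : realType) (n : nat)
    (f : 'cV[R]_n -> 'cV[R]_n) : Prop :=
  lyapunov_stable f /\ finite_time_convergent f.

Definition unit_simplex (R : realType) (N : nat) (alpha : 'I_N -> R) : Prop :=
  \sum_(i < N) alpha i = 1 /\ forall i, 0 <= alpha i.

Definition polytope_mx (R : realType) (n N : nat) (H : 'I_N -> 'M[R]_n)
    (alpha : 'I_N -> R) : 'M[R]_n :=
  \sum_(i < N) alpha i *: H i.

(* At x = 0 this takes the value 0, since 0^-1 = 0; the value at a single point
   does not affect the Filippov regularization. *)
Definition closed_loop (R : realType) (n : nat) (omega : R) (H K : 'M[R]_n)
    (x : 'cV[R]_n) : 'cV[R]_n :=
  omega^-1 *: (H *m K *m ((enorm x)^-1 *: x)).

(* Main.v *)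
(* The Lyapunov function is V x = x^T P x with P = X^-1. Writing y = P x, the
   upper left block of the LMI gives y^T H(alpha) L y <= - (mu / 8) |y|^2, so V
   decreases along the flow, and sqrt V decreases at a rate bounded away from 0
   as long as the solution has not reached the origin. The chain rule holds only
   almost everywhere, so monotonicity comes from the fact that an absolutely
   continuous function whose derivative is a.e. nonpositive is nonincreasing.
   Off the origin the field is continuous, so its Filippov regularization is
   single-valued there, and it is bounded everywhere. Hence solutions are
   Lipschitz and have a limit at a finite endpoint; from there they can be
   continued, by 0 if the limit is 0, and otherwise by the flow of the linear
   system z' = A z reparametrized by the time change t' = |z|. So a maximal
   solution is global. *)
Require Import Defs.
From HB Require Import structures.
From mathcomp Require Import all_boot all_order all_algebra.
From mathcomp Require Import all_classical all_reals all_analysis.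
From mathcomp Require Import measurable_realfun ring lra.

Set Implicit Arguments.
Unset Strict Implicit.
Unset Printing Implicit Defensive.

Import Order.TTheory GRing.Theory Num.Theory.
Import numFieldNormedType.Exports.

Local Open Scope classical_set_scope.
Local Open Scope ring_scope.

(** * Absolutely continuous functions with nonpositive derivative *)

(** Continuous induction: at the supremum of the points where [P] holds, the local step carries [P]
    from a point at or below the supremum to the supremum and past it, so the supremum is [b]. *)
Lemma interval_local_to_global (R : realType) (a b : R) (P : R -> Prop) :
  a <= b -> P a ->
  (forall t, a <= t <= b -> exists2 r, 0 < r &
    forall u v, a <= u -> t - r < u <= t -> t <= v < t + r -> v <= b ->
      P u -> P v) ->
  P b.
Proof.
move=> ab Pa loc.
pose S := [set c | a <= c <= b /\ P c].
have Sa : S a by rewrite /S /= lexx ab.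
have Sb : has_sup S by split; [exists a|exists b => c [/andP[]]].
have at_ : a <= sup S by apply: ub_le_sup => //; case: Sb.
have tb : sup S <= b by apply: ge_sup; [exists a|move=> c [/andP[]]].
have [|r r0 step] := loc (sup S); first by rewrite at_ tb.
have [u [/andP[au ub] Pu] ru] := sup_adherent r0 Sb.
have uS : u <= sup S by apply: ub_le_sup; [case: Sb|split=> //; rewrite au].
have next v : sup S <= v < sup S + r -> v <= b -> P v.
  by move=> h vb; apply: (step u v) => //; rewrite ru uS.
have [bS|Sb'] := leP b (sup S); first by apply: next => //; rewrite tb; lra.
have [h|h] := ltP b (sup S + r); first by apply: next => //; rewrite tb.
have Pv : P (sup S + r / 2) by apply: next; lra.
have : sup S + r / 2 <= sup S.
  by apply: ub_le_sup; [case: Sb|split=> //; lra].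
lra.
Qed.

(** Close to [t] the secants from [t] to [u] and from [t] to [v] have slope at most [e], and the two
    increments add up. Pairs straddling [t] are what [interval_local_to_global] asks for. *)
Lemma derive1_le0_straddle (R : realType) (g : R -> R) (t e : R) :
  derivable g t 1 -> derive1 g t <= 0 -> 0 < e ->
  exists2 r, 0 < r & forall u v, t - r < u <= t -> t <= v < t + r ->
    g v - g u <= e * (v - u).
Proof.
move=> dg dle e0.
have /cvgrPdist_lt /(_ e e0) : h^-1 *: (g (h + t) - g t) @[h --> 0^'] --> derive1 g t.
  rewrite derive1E; move: dg; rewrite /derivable /derive.
  by under eq_fun do rewrite [_%:A]mulr1.
move=> [r /= r0 hr]; exists r => // u v /andP[u1 u2] /andP[v1 v2].
have slope h : `|h| < r -> h != 0 -> h^-1 * (g (h + t) - g t) <= e.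
  move=> hlt h0; have := hr h; rewrite /ball_ /= sub0r normrN => /(_ hlt h0).
  by rewrite ltr_norml => /andP[+ _]; rewrite /GRing.scale /=; lra.
have right : g v - g t <= e * (v - t).
  have [->|vt] := eqVneq v t; first by rewrite !subrr mulr0.
  have vt0 : 0 < v - t by rewrite subr_gt0 lt_neqAle eq_sym vt.
  have := slope (v - t); rewrite gtr0_norm// subrK gt_eqF// => /(_ _ isT) H.
  by rewrite -ler_pdivrMr// mulrC H//; lra.
have left : g t - g u <= e * (t - u).
  have [->|ut] := eqVneq u t; first by rewrite !subrr mulr0.
  have ut0 : 0 < t - u by rewrite subr_gt0 lt_neqAle ut.
  have := slope (u - t); rewrite ltr0_norm ?subrK; last lra.
  rewrite lt_eqF; last lra.
  move=> /(_ _ isT); rewrite -opprB invrN mulNr -mulrN !opprB => H.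
  by rewrite -ler_pdivrMr// mulrC H//; lra.
lra.
Qed.

Definition abs_cont_on (R : realType) (a b : R) (g : R -> R) : Prop :=
  forall eps : R, 0 < eps -> exists delta : R, 0 < delta /\
  forall (m : nat) (s t : 'I_m -> R),
    (forall k, [&& a <= s k, s k <= t k & t k <= b]) ->
    trivIset [set: 'I_m] (fun k => [set u : R | s k < u < t k]) ->
    \sum_(k < m) (t k - s k) < delta ->
    \sum_(k < m) `|g (t k) - g (s k)| < eps.

(** By additivity the total length is the measure of the union. This turns an open set of small
    measure into the smallness condition of absolute continuity. *)
Lemma sum_itv_le_measure (R : realType) (U : set R) m (s t : 'I_m -> R) :
  measurable U -> (forall k, s k <= t k) ->
  trivIset [set: 'I_m] (fun k => [set u : R | s k < u < t k]) ->
  (forall k u, s k < u < t k -> U u) ->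
  ((\sum_(k < m) (t k - s k))%:E <= @lebesgue_measure R U)%E.
Proof.
move=> mU st dis sub.
have itvE k : [set u : R | s k < u < t k] = `](s k), (t k)[%classic.
  by apply/seteqP; split => u /=; rewrite in_itv.
have -> : (\sum_(k < m) (t k - s k))%:E =
    lebesgue_measure (\big[setU/set0]_(k < m) [set u : R | s k < u < t k]).
  rewrite measure_semi_additive_ord//.
  - rewrite -sumEFin; apply: eq_bigr => k _.
    rewrite /= itvE [RHS](@lebesgue_measure_itv R `](s k), (t k)[) /= lte_fin.
    case: ifPn => // /negP/negP; rewrite -leNgt => ts.
    by rewrite (_ : t k = s k) ?subrr//; apply/le_anti; rewrite ts st.
  - by move=> k; rewrite itvE; exact: measurable_itv.
  - by apply: bigsetU_measurable => k _; rewrite itvE; exact: measurable_itv.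
apply: le_measure; rewrite ?inE//.
- by apply: bigsetU_measurable => k _; rewrite itvE; exact: measurable_itv.
- apply: (big_ind (fun A => A `<=` U)) => //; last by move=> k _ u /sub.
  by move=> A B AU BU u [/AU|/BU].
Qed.

(** The exceptional null set is enclosed in an open [U] so small that absolute continuity bounds the
    increments over disjoint intervals in [U] by [e / 2]. Outside of [U] the slope bound [e1]
    applies and costs at most another [e / 2]. *)
Lemma abs_cont_derive1_le0_nincr (R : realType) (a b : R) (g : R -> R) :
  a <= b -> abs_cont_on a b g ->
  {ae @lebesgue_measure R, forall t, a <= t <= b ->
     derivable g t 1 /\ derive1 g t <= 0} ->
  g b <= g a.
Proof.
move=> ab acg [E [mE E0 PE]]; apply/ler_addgt0Pr => e e0.
pose e1 := e / 2 / (b - a + 1).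
have e10 : 0 < e1 by rewrite !divr_gt0//; lra.
have e1ab : e1 * (b - a) <= e / 2.
  rewrite /e1 mulrAC ler_pdivrMr; last lra.
  by apply: ler_wpM2l; lra.
have [d [d0 hd]] := acg (e / 2) ltac:(lra).
have [|U [oU EU muU]] := @lebesgue_regularity_outer R E d mE _ d0.
  by rewrite [X in (X < _)%E]E0 ltry.
have mU : measurable U by exact: measurable_realfun.open_measurable.
(* Outer regularity bounds the measure of [U] minus [E]; as [E] is null, the same bound holds for
   [U]. *)
have {}muU : (lebesgue_measure U < d%:E)%E.
  have UE : (lebesgue_measure U <= lebesgue_measure (U `\` E) + lebesgue_measure E)%E.
    apply: le_trans (measureU2 _ _ _) => //; last exact: measurableD.
    apply: le_measure; rewrite ?inE//; first by apply: measurableU => //; exact: measurableD.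
    by move=> u Uu; have [Eu|nEu] := pselect (E u); [right|left].
  by apply: le_lt_trans muU; apply: (le_trans UE); rewrite [X in (_ + X)%E]E0 adde0.
(* The bookkeeping for continuous induction: a finite chain of ordered intervals inside [U] carries
   the uncontrolled increments. The chain is indexed by [nat] so that an interval can be
   appended. *)
pose good c := exists (m : nat) (s t : nat -> R),
  [/\ forall k, (k < m)%N -> [&& a <= s k, s k <= t k & t k <= c],
      forall j k, (j < k < m)%N -> t j <= s k,
      forall k u, (k < m)%N -> s k < u < t k -> U u
    & g c - g a <= e1 * (c - a) + \sum_(k < m) `|g (t k) - g (s k)|].
have : good b.
  apply: (interval_local_to_global ab).
    by exists 0%N, (fun=> 0), (fun=> 0); split => //; rewrite big_ord0 !subrr mulr0 addr0.
  (* If [t] is in [U], the interval from [u] to [v] is appended to the chain. Otherwise the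
     derivative at [t] is nonpositive, the chain is kept, and the increment is paid by
     [e1 * (v - u)]. *)
  move=> t /andP[at_ tb]; have [Ut|nUt] := pselect (U t).
    have /nbhs_ballP[r /= r0 rU] : nbhs t U by exact: open_nbhs_nbhs.
    exists r => // u v au /andP[u1 u2] /andP[v1 v2] vb [m [s [t' [st ch sU gle]]]].
    exists m.+1, (fun k => if (k < m)%N then s k else u),
      (fun k => if (k < m)%N then t' k else v); split.
    - move=> k _; case: ifPn => [/st/and3P[-> -> /= tu]|_].
        by rewrite (le_trans tu)//; lra.
      by rewrite au lexx andbT; lra.
    - move=> j k /andP[jk]; rewrite ltnS leq_eqVlt => /orP[/eqP km|km].
        by rewrite -km jk ltnn; case/and3P: (st j ltac:(by rewrite -km)).
      by rewrite km (ltn_trans jk km) ch// jk.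
    - move=> k w _; case: ifPn => [km|_]; first exact: sU.
      by move=> wuv; apply: rU; rewrite /ball /= ltr_norml; lra.
    - rewrite big_ord_recr /= ltnn.
      under eq_bigr do rewrite ltn_ord.
      have := ler_norm (g v - g u).
      have : e1 * (u - a) <= e1 * (v - a) by apply: ler_wpM2l; lra.
      lra.
  have [dgt dgt0] : derivable g t 1 /\ derive1 g t <= 0.
    apply: contrapT => npt; apply/nUt/EU/PE => /= pt; apply: npt; apply: pt.
    by rewrite at_ tb.
  have [r r0 hr] := derive1_le0_straddle dgt dgt0 e10.
  exists r => // u v au uu vv vb [m [s [t' [st ch sU gle]]]].
  exists m, s, t'; split => //.
    move=> k /st/and3P[-> -> /= tu]; rewrite (le_trans tu)//.
    by case/andP: uu; case/andP: vv; lra.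
  have := hr _ _ uu vv; lra.
move=> [m [s [t [st ch sU gle]]]].
have dis : trivIset [set: 'I_m] (fun k => [set u : R | s k < u < t k]).
  apply/trivIsetP => i j _ _ ij; apply/seteqP; split => // u [/= /andP[u1 u2] /andP[u3 u4]].
  move: ij; rewrite neq_ltn => /orP[ij|ij].
    by have := ch i j; rewrite ij ltn_ord => /(_ isT); lra.
  by have := ch j i; rewrite ij ltn_ord => /(_ isT); lra.
have := hd m (fun k => s k) (fun k => t k) _ dis _.
have lt_d : \sum_(k < m) (t k - s k) < d.
  rewrite -lte_fin; apply: le_lt_trans muU; apply: sum_itv_le_measure => //.
    by move=> k; case/and3P: (st k (ltn_ord k)).
  by move=> k u; apply: sU.
move=> /(_ (fun k => st k (ltn_ord k)) lt_d).
lra.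
Qed.

(** * Null sets contain no cube *)

(* Integrating over the last coordinate reduces the dimension: the boxes whose
   last side contains x cover the slice at x. *)
Lemma cube_cover_volume (R : realType) (n : nat) (a b : nat -> nat -> R)
    (c : nat -> R) (r : R) (P : pred nat) :
  0 <= r -> (forall k i, a k i <= b k i) ->
  (forall y : nat -> R, (forall i, (i < n)%N -> c i - r <= y i <= c i + r) ->
     exists k, P k /\ forall i, (i < n)%N -> a k i <= y i <= b k i) ->
  (((2 * r) ^+ n)%:E <=
    \sum_(k <oo) ((P k)%:R * \prod_(i < n) (b k i - a k i))%:E)%E.
Proof.
move=> r0 ab; have vol0 m k : 0 <= \prod_(i < m) (b k i - a k i).
  by apply: prodr_ge0 => i _; rewrite subr_ge0.
elim: n P => [|n IH] P cov.
  have [k [Pk _]] := cov (fun=> 0) (fun i => ltac:(by [])).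
  have t0 j : (0%N <= j)%N -> true ->
      (0 <= ((P j)%:R * \prod_(i < 0) (b j i - a j i))%:E)%E.
    by move=> _ _; rewrite big_ord0 mulr1 lee_fin.
  apply: le_trans (nneseries_lim_ge k.+1 t0) => //.
  rewrite big_nat_recr //= -[leLHS]add0e; apply: leeD.
    by apply: sume_ge0 => j _; rewrite big_ord0 mulr1 lee_fin.
  by rewrite big_ord0 mulr1 Pk expr0.
pose mu := @lebesgue_measure R.
pose I := `[c n - r, c n + r]%classic : set (measurableTypeR R).
pose J k := `[a k n, b k n]%classic : set (measurableTypeR R).
pose F k (x : measurableTypeR R) :=
  ((P k)%:R * \prod_(i < n) (b k i - a k i) * \1_(J k) x)%:E.
have F0 k x : (0 <= F k x)%E by rewrite lee_fin !mulr_ge0// indicE.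
have mF k (D : set (measurableTypeR R)) : measurable D -> measurable_fun D (F k).
  move=> mD; apply/measurable_EFinP; apply: measurable_funM => //.
  by apply: measurable_indic; exact: measurable_itv.
(* This step is the reason for the parameter [P]: the induction hypothesis is applied to the same
   boxes with a smaller selection. *)
have slice x : I x -> (((2 * r) ^+ n)%:E <= \sum_(k <oo) F k x)%E.
  move=> Ix; apply: le_trans (IH [pred k | P k && (x \in J k)] _) _.
    move=> y hy; have [i /=|k [Pk hk]] := cov (fun i => if i == n then x else y i).
      rewrite ltnS leq_eqVlt; case: eqP => [->|_] /=; last exact: hy.
      by move: Ix; rewrite /I /= in_itv.
    exists k; split => /=.
      by rewrite Pk /= inE /J /= in_itv /=; have := hk n (ltnSn n); rewrite eqxx.
    by move=> i ilt; have := hk i (ltnW ilt); rewrite ltn_eqF.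
  apply: lee_nneseries => [k _ _|k _] /=; first by rewrite lee_fin mulr_ge0 ?ler0n ?vol0.
  rewrite lee_fin /F indicE.
  by case: (P k); case: (x \in J k); rewrite /= ?mul0r ?mul1r ?mulr0 ?mulr1.
have intI : (\int[mu]_(x in I) ((2 * r) ^+ n)%:E = ((2 * r) ^+ n.+1)%:E)%E.
  rewrite integral_cst//; last exact: measurable_itv.
  rewrite /mu [X in (_ * X)%E](@lebesgue_measure_itv R `[c n - r, c n + r]) /= lte_fin.
  case: ltP => h; first by rewrite -EFinD -EFinM exprSr; congr (_ * _)%:E; ring.
  have -> : r = 0 by apply/le_anti; rewrite r0 andbT; lra.
  by rewrite mulr0 exprS mul0r mule0.
rewrite -intI.
apply: (@le_trans _ _ (\int[mu]_(x in I) (\sum_(k <oo) F k x))%E).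
  apply: ge0_le_integral => //.
  - exact: measurable_itv.
  - by move=> x _; rewrite lee_fin exprn_ge0// mulr_ge0.
  - apply: (@ge0_emeasurable_sum _ _ _ _ _ xpredT) => // k _.
    by apply: mF; exact: measurable_itv.
have mI : measurable I by exact: measurable_itv.
rewrite (integral_nneseries _ mI (fun k => mF k I mI) (fun k x _ => F0 k x)).
apply: lee_nneseries => [k _ _|k _]; first by apply: integral_ge0.
(* Enlarging the domain from [I] to the whole line can only increase the integral, and there the
   indicator of [J k] integrates to the full length of the last side. *)
apply: le_trans (ge0_subset_integral _ mI measurableT (mF k setT measurableT) _ _) _ => //.
have w0 : 0 <= (P k)%:R * \prod_(i < n) (b k i - a k i) by rewrite mulr_ge0.
have mJ : measurable (J k) by exact: measurable_itv.
rewrite /F; under eq_integral do rewrite EFinM.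
rewrite ge0_integralZl_EFin//; last by apply/measurable_EFinP; exact: measurable_indic.
rewrite integral_indic// setIT /mu.
rewrite [X in (_ * X)%E](@lebesgue_measure_itv R `[a k n, b k n]) /= lte_fin.
rewrite big_ord_recr /= mulrA; case: ltP => h; first by rewrite -EFinD -EFinM.
by rewrite mule0 lee_fin mulr_ge0// subr_ge0.
Qed.

(** Otherwise the cube, of volume [(2 * r) ^+ n], would be covered by boxes of at most half that
    total volume, contradicting [cube_cover_volume]. *)
Lemma lebesgue_null_cube (R : realType) (n : nat) (S : set 'cV[R]_n)
    (z : 'cV[R]_n) (r : R) :
  0 < r -> lebesgue_null S ->
  exists y, ~ S y /\ forall i, `|y i 0 - z i 0| <= r.
Proof.
move=> r0 nS; apply: contrapT => nex.
have sub (y : 'cV[R]_n) : (forall i, `|y i 0 - z i 0| <= r) -> S y.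
  by move=> hy; apply: contrapT => nSy; apply: nex; exists y.
have [a [b [ab Scov vol]]] := nS ((2 * r) ^+ n / 2)
  ltac:(by rewrite divr_gt0// exprn_gt0 ?mulr_gt0).
(* Vectors are padded with zeros to sequences, the form in which the induction on the dimension was
   carried out. *)
pose ext (y : 'cV[R]_n) (i : nat) : R := if insub i is Some j then y j 0 else 0.
have extE (y : 'cV[R]_n) (i : 'I_n) : ext y i = y i 0 by rewrite /ext valK.
have ext_le k i : ext (a k) i <= ext (b k) i by rewrite /ext; case: insubP.
have := @cube_cover_volume R n (fun k => ext (a k)) (fun k => ext (b k)) (ext z) r
  predT (ltW r0) ext_le.
have cov (y : nat -> R) :
    (forall i, (i < n)%N -> ext z i - r <= y i <= ext z i + r) ->
    exists k, predT k /\ forall i, (i < n)%N -> ext (a k) i <= y i <= ext (b k) i.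
  move=> hy; have /sub/Scov[k _ hk] : forall i, `|(\col_(j < n) y j) i 0 - z i 0| <= r.
    by move=> i; have := hy i (ltn_ord i); rewrite extE mxE ler_norml; lra.
  exists k; split => // i ilt.
  by have := hk (Ordinal ilt); rewrite mxE -!extE.
move=> /(_ cov); apply/negP; rewrite -ltNge.
apply: (@le_lt_trans _ _ ((2 * r) ^+ n / 2)%:E).
  apply: le_trans vol; apply: lee_nneseries => [k _ _|k _].
    rewrite mul1r lee_fin; apply: prodr_ge0 => i _.
    by rewrite subr_ge0.
  by rewrite mul1r lee_fin; under eq_bigr do rewrite !extE.
have : 0 < (2 * r) ^+ n by rewrite exprn_gt0 ?mulr_gt0.
by rewrite lte_fin; lra.
Qed.

(** * Filippov regularization of the normalized linear field *)

Lemma cvg_ord_sum (R : realType) (T : Type) (F : set_system T) {FF : Filter F}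
    (n : nat) (f : 'I_n -> T -> R) (l : 'I_n -> R) :
  (forall i, f i x @[x --> F] --> l i) ->
  \sum_(i < n) f i x @[x --> F] --> \sum_(i < n) l i.
Proof. by move=> fl; apply: cvg_big => //; exact: add_continuous. Qed.

Section euclidean_norm.
Variables (R : realType) (n : nat).
Implicit Types (x y : 'cV[R]_n).

Lemma enorm_ge0 x : 0 <= enorm x. Proof. exact: sqrtr_ge0. Qed.

Lemma sqr_enorm x : enorm x ^+ 2 = \sum_(i < n) x i 0 ^+ 2.
Proof. by rewrite sqr_sqrtr// sumr_ge0// => i _; exact: sqr_ge0. Qed.

Lemma coord_le_enorm x i : `|x i 0| <= enorm x.
Proof.
rewrite -sqrtr_sqr ler_sqrt ?sumr_ge0// => [|j _]; last exact: sqr_ge0.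
by rewrite (bigD1 i)//= lerDl sumr_ge0// => j _; exact: sqr_ge0.
Qed.

Lemma enorm_le_sum x : enorm x <= \sum_(i < n) `|x i 0|.
Proof.
have s0 : 0 <= \sum_(i < n) `|x i 0| by rewrite sumr_ge0.
rewrite -(ler_pXn2r (_ : 0 < 2)%N) ?nnegrE ?enorm_ge0// sqr_enorm.
rewrite [leRHS]expr2 mulr_suml; apply: ler_sum => i _.
rewrite -real_normK ?num_real// expr2 ler_wpM2l//.
by rewrite (bigD1 i)//= lerDl sumr_ge0.
Qed.

Lemma enorm0 : enorm (0 : 'cV[R]_n) = 0.
Proof. by rewrite /enorm big1 ?sqrtr0// => i _; rewrite mxE expr0n. Qed.

Lemma enorm_eq0 x : enorm x = 0 -> x = 0.
Proof.
move=> x0; apply/colP => i; rewrite mxE; apply/normr0_eq0/le_anti.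
by rewrite normr_ge0 andbT -x0 coord_le_enorm.
Qed.

Lemma enorm_gt0 x : x != 0 -> 0 < enorm x.
Proof.
move=> x0; rewrite lt_neqAle enorm_ge0 andbT eq_sym; apply: contraNN x0.
by move=> /eqP H; apply/eqP; exact: enorm_eq0.
Qed.

Lemma enormN x : enorm (- x) = enorm x.
Proof. by rewrite /enorm; under eq_bigr do rewrite mxE sqrrN. Qed.

Lemma continuous_enorm : continuous (@enorm R n).
Proof.
move=> x; apply: (@continuous_comp _ _ _
  (fun x : 'cV[R]_n => \sum_(i < n) x i 0 ^+ 2) Num.sqrt).
  apply: (@cvg_ord_sum _ _ (nbhs x)) => i.
  apply: (@continuous_comp _ _ _ (fun x : 'cV[R]_n => x i 0) (fun u => u ^+ 2)).
    exact: coord_continuous.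
  exact: exprn_continuous.
exact: sqrt_continuous.
Qed.

(** The sum of the absolute values of the entries is a crude substitute for the operator norm. *)
Lemma bilinear_bound (A : 'M[R]_n) x y :
  `|(x^T *m A *m y) 0 0| <= (\sum_(i < n) \sum_(j < n) `|A i j|) * (enorm x * enorm y).
Proof.
rewrite mxE; apply: le_trans (ler_norm_sum _ _ _) _.
rewrite exchange_big /= mulr_suml; apply: ler_sum => j _; rewrite mxE !mulr_suml.
apply: le_trans (ler_norm_sum _ _ _) _; apply: ler_sum => i _.
rewrite mxE !normrM (mulrC `|x _ _|) -mulrA; apply: ler_wpM2l => //.
by apply: ler_pM; rewrite ?coord_le_enorm.
Qed.

End euclidean_norm.

(** The closed loop with the scalar and both matrices merged into the single matrix [A]. *)
Definition unit_field (R : realType) (n : nat) (A : 'M[R]_n) (x : 'cV[R]_n) :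
    'cV[R]_n :=
  (enorm x)^-1 *: (A *m x).

Section unit_field.
Variables (R : realType) (n : nat) (A : 'M[R]_n).
Implicit Types (x v : 'cV[R]_n).

Lemma unit_fieldE x i :
  unit_field A x i 0 = (enorm x)^-1 * \sum_(j < n) A i j * x j 0.
Proof. by rewrite /unit_field !mxE. Qed.

Lemma unit_fieldN x : unit_field A (- x) = - unit_field A x.
Proof. by rewrite /unit_field enormN mulmxN scalerN. Qed.

Lemma unit_field_bound x i : `|unit_field A x i 0| <= \sum_(j < n) `|A i j|.
Proof.
have [->|x0] := eqVneq x 0.
  by rewrite /unit_field mulmx0 scaler0 mxE normr0 sumr_ge0.
have xp := enorm_gt0 x0.
rewrite unit_fieldE normrM ger0_norm ?invr_ge0 ?enorm_ge0// ler_pdivrMl// mulr_sumr.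
apply: le_trans (ler_norm_sum _ _ _) _; apply: ler_sum => j _.
by rewrite normrM mulrC; apply: ler_wpM2r => //; exact: coord_le_enorm.
Qed.

Lemma continuous_unit_field x i : x != 0 ->
  unit_field A y i 0 @[y --> x] --> unit_field A x i 0.
Proof.
move=> x0; rewrite unit_fieldE; under eq_fun do rewrite unit_fieldE.
apply: (@cvgM _ _ (nbhs x) _ (fun y => (enorm y)^-1)
  (fun y : 'cV[R]_n => \sum_(j < n) A i j * y j 0)).
  apply: (@continuousV _ _ (@enorm R n)); first by rewrite gt_eqF ?enorm_gt0.
  exact: continuous_enorm.
apply: cvg_ord_sum => j; apply: cvgM; first exact: cvg_cst.
exact: coord_continuous.
Qed.

End unit_field.

Section filippov_hull.
Variables (R : realType) (n : nat).
Implicit Types (f : 'cV[R]_n -> 'cV[R]_n) (x v : 'cV[R]_n).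

(* In dimension 0 every box has volume 1, so not even set0 is null. *)
Lemma lebesgue_null0 : lebesgue_null (set0 : set 'cV[R]_n.+1).
Proof.
move=> e e0; exists (fun=> 0), (fun=> 0); split => //.
rewrite eseries0 ?lee_fin ?ltW// => k _ _.
by rewrite big_ord_recl mxE subrr mul0r.
Qed.

(** A coordinate half-space is closed and convex, so it contains the hull of each of its subsets. *)
Lemma closed_convex_hull_coord_le (S : set 'cV[R]_n) i (c : R) v :
  (forall y, S y -> y i 0 <= c) -> closed_convex_hull S v -> v i 0 <= c.
Proof.
move=> Sc hull; apply: (hull [set y | y i 0 <= c]); split => //; split.
  apply: (@preimage_closed _ _ (fun y : 'cV[R]_n => y i 0) [set z | z <= c]).
    by move=> y _; exact: coord_continuous.
  exact: closed_le.
move=> y z t; rewrite !inE /= => yc zc.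
rewrite /conv /= !mxE /unstable.onem.
have t0 : 0 <= t%:num by []. have t1 : t%:num <= 1 by [].
have := ler_wpM2l t0 yc; have := @ler_wpM2l _ (1 - t%:num) _ _ _ zc.
by rewrite subr_ge0 => /(_ t1); lra.
Qed.

Lemma closed_convex_hull_coord_ge (S : set 'cV[R]_n) i (c : R) v :
  (forall y, S y -> c <= y i 0) -> closed_convex_hull S v -> c <= v i 0.
Proof.
move=> Sc hull; apply: (hull [set y | c <= y i 0]); split => //; split.
  apply: (@preimage_closed _ _ (fun y : 'cV[R]_n => y i 0) [set z | c <= z]).
    by move=> y _; exact: coord_continuous.
  exact: closed_ge.
move=> y z t; rewrite !inE /= => yc zc.
rewrite /conv /= !mxE /unstable.onem.
have t0 : 0 <= t%:num by []. have t1 : t%:num <= 1 by [].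
have := ler_wpM2l t0 yc; have := @ler_wpM2l _ (1 - t%:num) _ _ _ zc.
by rewrite subr_ge0 => /(_ t1); lra.
Qed.


Lemma filippov_bound f x v i (c : R) :
  (forall y, `|f y i 0| <= c) -> lebesgue_null (set0 : set 'cV[R]_n) ->
  filippov f x v -> `|v i 0| <= c.
Proof.
move=> fc null0 /(_ 1 _ ltr01 null0) hull; rewrite ler_norml; apply/andP; split.
  apply: closed_convex_hull_coord_ge hull => _ [y _ <-].
  by have := fc y; rewrite ler_norml => /andP[].
apply: closed_convex_hull_coord_le hull => _ [y _ <-].
by have := fc y; rewrite ler_norml => /andP[].
Qed.

Lemma eball_nbhs x (S : set 'cV[R]_n) : nbhs x S ->
  exists2 d : R, 0 < d & eball x d `<=` S.
Proof.
move=> /nbhs_ballP[d /= d0 dS]; exists d => // y xy; apply: dS; split => // i j.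
rewrite /ball /= ord1 distrC; apply: le_lt_trans xy.
by have := coord_le_enorm (y - x) i; rewrite !mxE.
Qed.

(** On a small ball each coordinate of [f] stays within [e] of its value at [x]; slabs of this kind
    are inherited by the hull, and [e] is arbitrary. *)
Lemma filippov_continuous_eq f x v :
  lebesgue_null (set0 : set 'cV[R]_n) ->
  (forall i, f y i 0 @[y --> x] --> f x i 0) ->
  filippov f x v -> v = f x.
Proof.
move=> null0 cf Fv; apply/colP => i; apply/eqP; rewrite -subr_eq0 -normr_le0.
apply/ler_addgt0Pr => e e0; rewrite add0r.
have /cvgrPdist_le /(_ e e0) /eball_nbhs[d d0 dfx] := cf i.
have hull := Fv d set0 d0 null0.
rewrite ler_norml; apply/andP; split.
  rewrite lerBrDr addrC; apply: closed_convex_hull_coord_ge hull => _ [y [+ _] <-].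
  by move=> /dfx /=; rewrite ler_norml => /andP[]; lra.
rewrite lerBlDr addrC; apply: closed_convex_hull_coord_le hull => _ [y [+ _] <-].
by move=> /dfx /=; rewrite ler_norml => /andP[]; lra.
Qed.

(* The complement of a null set is dense, so removing S does not affect the
   values of f at its points of continuity. *)
Lemma continuous_closed_convex_hull f x z (d : R) (S : set 'cV[R]_n) :
  eball x d z -> lebesgue_null S ->
  (forall i, f y i 0 @[y --> z] --> f z i 0) ->
  closed_convex_hull (f @` (eball x d `\` S)) (f z).
Proof.
move=> xz nS cf C [[clC _] SC]; apply: clC => B /nbhs_ballP[e /= e0 eB].
have : \forall y \near z, enorm (y - x) < d /\ forall i, `|f z i 0 - f y i 0| < e.
  near=> y; split.
    near: y; have : enorm (y - x) @[y --> z] --> enorm (z - x).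
      apply: (@continuous_comp _ _ _ (fun y : 'cV[R]_n => y - x) (@enorm R n)).
        by apply: (@cvgB _ _ _ (nbhs z) _ id (cst x)); [exact: cvg_id|exact: cvg_cst].
      exact: continuous_enorm.
    by move/cvgr_lt; apply.
  move=> i; move: i; near: y; apply: filter_forall => i.
  by have /cvgrPdist_lt := cf i; apply.
move=> /eball_nbhs[r r0 rz].
(* A cube of half side [r / n.+1] lies in the open Euclidean ball of radius [r], because the norm is
   at most the sum of the [n] coordinates in absolute value. *)
have r1 : 0 < r / (n.+1)%:R by rewrite divr_gt0.
have [y [nSy yz]] := lebesgue_null_cube z r1 nS.
have /rz[yx fy] : eball z r y.
  rewrite /eball /=; apply: le_lt_trans (enorm_le_sum _) _.
  apply: (@le_lt_trans _ _ (\sum_(i < n) r / (n.+1)%:R)).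
    by apply: ler_sum => i _; rewrite !mxE.
  rewrite sumr_const card_ord -[ltLHS]mulr_natr mulrAC ltr_pdivrMr// ltr_pM2l//.
  by rewrite ltr_nat.
exists (f y); split; first by apply: SC; exists y.
by apply: eB; split => // i j; rewrite /ball /= ord1.
Unshelve. all: by end_near. Qed.

End filippov_hull.

Section filippov_unit_field.
Variables (R : realType) (n : nat) (A : 'M[R]_n.+1).

Lemma filippov_unit_field_neq0 x v : x != 0 ->
  filippov (unit_field A) x v -> v = unit_field A x.
Proof.
move=> x0; apply: filippov_continuous_eq; first exact: lebesgue_null0.
by move=> i; exact: continuous_unit_field.
Qed.

Lemma filippov_unit_field_bound x v i :
  filippov (unit_field A) x v -> `|v i 0| <= \sum_(j < n.+1) `|A i j|.
Proof.
apply: filippov_bound; last exact: lebesgue_null0.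
by move=> y; exact: unit_field_bound.
Qed.

(** Off the origin this is continuity. At the origin the field is odd, so 0 is the midpoint of its
    values at [z] and [- z]. It certifies that the continuations constructed below are Filippov
    solutions. *)
Lemma filippov_unit_field_mem x : filippov (unit_field A) x (unit_field A x).
Proof.
move=> d S d0 nS; have [->|x0] := eqVneq x 0; last first.
  apply: continuous_closed_convex_hull => //;
    last by move=> i; exact: continuous_unit_field.
  by rewrite /eball /= subrr enorm0.
(* Any nonzero vector of the ball would do; the [n.+1] entries [d / n.+2%:R] add up to less than
   [d]. *)
pose z : 'cV[R]_n.+1 := const_mx (d / n.+2%:R).
have z0 : z != 0.
  apply/eqP => /colP/(_ ord0); rewrite !mxE => /eqP.
  by rewrite gt_eqF// divr_gt0.
have zd : enorm z < d.
  apply: le_lt_trans (enorm_le_sum _) _.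
  under eq_bigr do rewrite mxE ger0_norm ?divr_ge0 ?ltW//.
  rewrite sumr_const card_ord -[ltLHS]mulr_natr mulrAC ltr_pdivrMr// ltr_pM2l//.
  by rewrite ltr_nat.
have hull w : w != 0 -> enorm w < d ->
    closed_convex_hull (unit_field A @` (eball 0 d `\` S)) (unit_field A w).
  move=> w0 wd; apply: continuous_closed_convex_hull => //;
    last by move=> i; exact: continuous_unit_field.
  by rewrite /eball /= subr0.
move=> C [[clC cvC] SC].
have h1 : C (unit_field A z) by apply: (hull z).
have h2 : C (unit_field A (- z)) by apply: (hull (- z)); rewrite ?oppr_eq0 ?enormN.
have half0 : 0 <= 2^-1 :> R by rewrite invr_ge0.
have half1 : 2^-1 <= 1 :> R by rewrite invf_le1 ?ler1n.
have := cvC (unit_field A z) (unit_field A (- z)) (Itv01 half0 half1).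
rewrite !inE => /(_ h1 h2); rewrite /conv /= unit_fieldN /unstable.onem.
rewrite /unit_field mulmx0 scaler0 scalerN.
set u := _ *: (A *m z); have -> : (1 - 2^-1 : R) = 2^-1 by lra.
by rewrite subrr.
Qed.

End filippov_unit_field.

(** * Local solutions *)

Section linear_flow.
Variables (R : realType) (n : nat) (A : 'M[R]_n).
Implicit Types x : 'cV[R]_n.

(** The Taylor coefficients at 0 of the [i]-th coordinate of $e^{tA}x$. *)
Let coef x (i : 'I_n) (k : nat) : R := iter k (mulmx A) x i 0 / k`!%:R.

Let coef_pseries_diffs x i : pseries_diffs (coef x i) = coef (A *m x) i.
Proof.
apply/funext => k; rewrite /pseries_diffs /coef -iterSr factS natrM invfM.
by rewrite mulrCA mulVKf.
Qed.

Let norm_iter_mulmx x i k : `|iter k (mulmx A) x i 0| <=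
  (\sum_j \sum_l `|A j l|) ^+ k * \sum_j `|x j 0|.
Proof.
elim: k i => [|k IH] i.
  by rewrite expr0 mul1r (bigD1 i)//= lerDl sumr_ge0.
rewrite iterS mxE exprS -mulrA; apply: le_trans (ler_norm_sum _ _ _) _.
set q := _ ^+ k * _ in IH *.
have q0 : 0 <= q by apply: le_trans (IH i).
apply: (@le_trans _ _ ((\sum_l `|A i l|) * q)).
  by rewrite mulr_suml; apply: ler_sum => j _; rewrite normrM ler_wpM2l.
apply: ler_wpM2r => //; rewrite [leRHS](bigD1 i)//= lerDl sumr_ge0// => j _.
exact: sumr_ge0.
Qed.

(** The series is dominated by [b] times the exponential series at [a * |t|]. *)
Let is_cvg_pseries_coef x i t : cvgn (pseries (coef x i) t).
Proof.
pose a := \sum_j \sum_l `|A j l|.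
pose b := \sum_j `|x j 0|.
apply: normed_cvg.
apply: (@series_le_cvg _ _ (fun k => b * exp_coeff (a * `|t|) k)) => [k|k|k|].
- exact: normr_ge0.
- rewrite mulr_ge0 ?sumr_ge0// /exp_coeff /= divr_ge0// exprn_ge0// mulr_ge0//.
  by apply: sumr_ge0 => j _; exact: sumr_ge0.
- rewrite /coef /exp_coeff /= !normrM normrX exprMn (ger0_norm (_ : 0 <= _^-1))//.
  rewrite mulrAC [leRHS]mulrA; apply: ler_wpM2r; first by rewrite invr_ge0.
  rewrite mulrA; apply: ler_wpM2r; first exact: exprn_ge0.
  by rewrite mulrC; exact: norm_iter_mulmx.
- exact/is_cvg_seriesZ/is_cvg_series_exp_coeff.
Qed.

(** The solution is $e^{tA}x$, differentiated term by term: the formal derivative of the series for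
    [x] is the series for [A *m x]. *)
Lemma linear_flow x : exists z : R -> 'cV[R]_n, z 0 = x /\
  forall (t : R) i, is_derive t 1 (fun s => z s i 0) ((A *m z t) i 0).
Proof.
exists (fun t => \col_i limn (pseries (coef x i) t)); split.
  apply/colP => i; rewrite mxE; apply/cvg_lim => //.
  (* After the shift every partial sum contains the constant term, the only one that survives at
     time 0. *)
  rewrite -cvg_shiftS /=; under eq_fun => N.
    rewrite /pseries /series /= big_nat_recl//= expr0 mulr1.
    rewrite big1; last by move=> k _; rewrite exprS mul0r mulr0.
    over.
  by rewrite addr0 /coef /= divr1; exact: cvg_cst.
move=> t i; rewrite (_ : (A *m _) i 0 = limn (pseries (coef (A *m x) i) t)).
  under eq_fun do rewrite mxE.
  (* Termwise differentiation at [t] asks for convergence of the series and of its first two formal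
     derivatives at a point beyond [|t|]; all three converge everywhere. *)
  rewrite -coef_pseries_diffs; apply: (@pseries_snd_diffs _ _ (`|t| + 1)).
  - exact: is_cvg_pseries_coef.
  - by rewrite coef_pseries_diffs; exact: is_cvg_pseries_coef.
  - by rewrite !coef_pseries_diffs; exact: is_cvg_pseries_coef.
  - by rewrite [ltRHS]ger0_norm ?addr_ge0// ltrDl.
apply/esym/cvg_lim => //.
rewrite mxE; under eq_bigr do rewrite mxE.
rewrite (_ : pseries _ _ = fun N => \sum_j A i j * pseries (coef x j) t N).
  apply: (@cvg_ord_sum _ _ \oo) => j; apply: (@cvgMr _ _ \oo).
  exact: is_cvg_pseries_coef.
apply/funext => N; rewrite /pseries /series /=.
under [RHS]eq_bigr do rewrite mulr_sumr.
rewrite exchange_big /=; apply: eq_bigr => k _.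
rewrite /coef -iterSr iterS mxE !mulr_suml; apply: eq_bigr => j _.
by rewrite !mulrA.
Qed.

End linear_flow.

(** If $z'=Az$ and [tau] is the integral of $\|z\|$ from 0, then $z\circ\tau^{-1}$ has derivative
    $Az/\|z\|$ by the chain rule. *)
Lemma unit_field_local_solution (R : realType) (n : nat) (A : 'M[R]_n) x0 :
  x0 != 0 -> exists (h : R) (w : R -> 'cV[R]_n),
  [/\ 0 < h, w 0 = x0 & forall t, 0 <= t < h -> forall i,
     is_derive t 1 (fun s => w s i 0) (unit_field A (w t) i 0)].
Proof.
move=> x00; have [z [z0 dz]] := linear_flow A x0.
have cz i : continuous (fun s => z s i 0).
  by move=> s; apply/differentiable_continuous/derivable1_diffP; case: (dz s i).
pose g s := enorm (z s).
have cg : continuous g.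
  move=> s; apply: (@continuous_comp _ _ _ (fun s => \sum_(i < n) z s i 0 ^+ 2) Num.sqrt).
    apply: (@cvg_ord_sum _ _ (nbhs s)) => i.
    apply: (@continuous_comp _ _ _ (fun s => z s i 0) (fun u => u ^+ 2)); first exact: cz.
    exact: exprn_continuous.
  exact: sqrt_continuous.
have g00 : 0 < g 0 by rewrite /g z0 enorm_gt0.
have [h h0 gpos] : exists2 h : R, 0 < h & forall s, `|s| < h -> 0 < g s.
  have /cvgrPdist_lt /(_ _ g00) /nbhs_ballP[h /= h0 hg] := cg 0.
  exists h => // s sh; have := hg s; rewrite /ball /= sub0r normrN => /(_ sh).
  by rewrite ltr_norml => /andP[]; lra.
(* Integrating from [- h] and subtracting [G 0] afterwards makes [tau] differentiable from both
   sides at 0. *)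
pose G (s : R) : R := (\int[lebesgue_measure]_(u in `[- h, s]) g u)%R.
pose tau (s : R) : R := G s - G 0.
have dtau (s : R) : `|s| < h -> is_derive s 1 tau (g s).
  move=> sh; have [s1 s2] : - h < s /\ s < h by move: sh; rewrite ltr_norml => /andP[].
  have ig : lebesgue_measure.-integrable `[- h, h] (EFin \o g).
    apply: continuous_compact_integrable; first exact: segment_compact.
    exact: continuous_subspaceT.
  have [dG eG] : derivable G s 1 /\ derive1 G s = g s.
    exact: continuous_FTC1_closed s2 ig s1 (cg s).
  rewrite derive1E in eG; have dG' := DeriveDef dG eG.
  rewrite -[g s]subr0; exact: is_deriveB.
have ctau (s : R) : `|s| < h -> {for s, continuous tau}.
  by move=> /dtau[d _]; apply/differentiable_continuous/derivable1_diffP.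
have incr (a b : R) : `|a| < h -> `|b| < h -> a < b -> tau a < tau b.
  move=> ah bh ab.
  have abh c : a <= c <= b -> `|c| < h.
    by move: ah bh; rewrite !ltr_norml; lra.
  apply: (@gtr0_derive1_lt_cc _ tau a b) => //.
  - move=> c; rewrite in_itv /= => /andP[c1 c2]; have [] // := dtau c.
    by apply: abh; rewrite !ltW.
  - move=> c; rewrite in_itv /= => /andP[c1 c2].
    have ch : `|c| < h by apply: abh; rewrite !ltW.
    by rewrite derive1E; have [_ ->] := dtau c ch; exact: gpos.
  - apply: continuous_in_subspaceT => c; rewrite inE /= in_itv /= => /abh.
    exact: ctau.
  - by rewrite in_itv /= lexx ltW.
  - by rewrite in_itv /= lexx ltW.
have inj (s t : R) : `|s| < h -> `|t| < h -> tau s = tau t -> s = t.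
  move=> sh th; have [st|ts|//] := ltgtP s t.
    by have := incr _ _ sh th st; lra.
  by have := incr _ _ th sh ts; lra.
(* The inverse of [tau] by choice; the default 0 is taken only off the range of [tau]. *)
pose sigma (t : R) : R := xget 0 [set s | `|s| < h /\ tau s = t].
have sigmaK (s : R) : `|s| < h -> sigma (tau s) = s.
  move=> sh; rewrite /sigma; case: xgetP => [u _ [uh eu]|/(_ s) []]//.
  exact: inj.
have dsigma (s : R) : `|s| < h -> is_derive (tau s) 1 sigma (g s)^-1.
  move=> sh; have near_sh : \forall u \near s, `|u| < h.
    by have /cvgr_lt := @norm_continuous _ R s; apply.
  apply: is_derive_inverse.
  - by apply: filterS near_sh => u; exact: sigmaK.
  - by apply: filterS near_sh => u; exact: ctau.
  - exact: dtau.
  - by rewrite gt_eqF ?gpos.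
have h2 : `|h / 2| < h by rewrite ger0_norm; lra.
have n0 : `|0 : R| < h by rewrite normr0.
have tau0 : tau 0 = 0 by rewrite /tau subrr.
(* Stopping at [h / 2] keeps the whole segment inside the open interval where [tau] is controlled;
   the intermediate value theorem then gives each time a preimage. *)
exists (tau (h / 2)), (z \o sigma); split.
- by rewrite -tau0; apply: incr => //; lra.
- by rewrite /= -tau0 sigmaK.
- move=> t /andP[t0 th] i.
  have [s sh ts] : exists2 s, `|s| < h & tau s = t.
    have [|||s] := @IVT R tau 0 (h / 2) t.
    + lra.
    + apply: continuous_in_subspaceT => c; rewrite inE /= in_itv /= => ch.
      by apply: ctau; rewrite ltr_norml; lra.
    + by rewrite tau0 ge_min t0 le_max (ltW th) orbT.
    rewrite in_itv /= => s1 s2; exists s => //.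
    by rewrite ltr_norml; lra.
  have := dsigma s sh; rewrite ts => ds.
  have st : sigma t = s by rewrite -ts sigmaK.
  rewrite /unit_field mxE /= -/(g (sigma t)) {1}st mulrC.
  exact: is_derive1_comp (dz (sigma t) i) ds.
Qed.

(** * Solutions are Lipschitz *)

(** The exceptional point [p] serves for the seam of a glued solution; in the other uses it is an
    arbitrary choice. *)
Lemma lebesgue_ae_imply (R : realType) (P Q : R -> Prop) (p : R) :
  (forall t, t != p -> P t -> Q t) ->
  {ae @lebesgue_measure R, forall t, P t} ->
  {ae @lebesgue_measure R, forall t, Q t}.
Proof.
move=> PQ aeP; have aep : (@lebesgue_measure R).-negligible [set p].
  exists [set p]; split => //; exact: lebesgue_measure_set1.
apply: (negligibleS _ (negligibleU aeP aep)) => t /= nQ.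
have [->|tp] := eqVneq t p; [by right|left => Pt; exact/nQ/PQ].
Qed.

Section abs_cont.
Variable R : realType.
Implicit Types (g h : R -> R) (a b c C : R).

Lemma abs_cont_onS a b a' b' g : a <= a' -> b' <= b ->
  abs_cont_on a b g -> abs_cont_on a' b' g.
Proof.
move=> aa bb acg e e0; have [d [d0 hd]] := acg e e0; exists d; split=> // m s t st.
by apply: hd => k; case/and3P: (st k) => h1 -> h2; rewrite (le_trans aa h1) (le_trans h2 bb).
Qed.

Lemma abs_cont_onD a b g h :
  abs_cont_on a b g -> abs_cont_on a b h -> abs_cont_on a b (g \+ h).
Proof.
move=> acg ach e e0.
have [d1 [d10 hd1]] := acg (e / 2) ltac:(lra).
have [d2 [d20 hd2]] := ach (e / 2) ltac:(lra).
exists (Num.min d1 d2); split; first by rewrite lt_min d10.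
move=> m s t st dis; rewrite lt_min => /andP[l1 l2].
have := hd1 m s t st dis l1; have := hd2 m s t st dis l2.
set S1 := \sum_(k < m) _; set S2 := \sum_(k < m) _ => H2 H1.
apply: (@le_lt_trans _ _ (S2 + S1)); last lra.
rewrite -big_split /=; apply: ler_sum => k _.
by rewrite opprD addrACA; exact: ler_normD.
Qed.

Lemma lipschitz_abs_cont_on a b C g : 0 <= C ->
  (forall s t, a <= s -> s <= t -> t <= b -> `|g t - g s| <= C * (t - s)) ->
  abs_cont_on a b g.
Proof.
move=> C0 lip e e0; exists (e / (C + 1)); split; first by rewrite divr_gt0//; lra.
move=> m s t st _ lt_d.
apply: (@le_lt_trans _ _ (C * \sum_(k < m) (t k - s k))).
  by rewrite mulr_sumr; apply: ler_sum => k _; case/and3P: (st k) => *; exact: lip.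
have s0 : 0 <= \sum_(k < m) (t k - s k).
  by apply: sumr_ge0 => k _; case/and3P: (st k) => *; rewrite subr_ge0.
rewrite ltr_pdivlMr in lt_d; last lra.
by apply: le_lt_trans lt_d; rewrite mulrC; apply: ler_wpM2l => //; lra.
Qed.

(** The nonpositive case applied to [g] minus the linear function of slope [C]. *)
Lemma abs_cont_derive1_le a b g C : a <= b -> abs_cont_on a b g ->
  {ae @lebesgue_measure R, forall t, a <= t <= b ->
     derivable g t 1 /\ derive1 g t <= C} ->
  g b - g a <= C * (b - a).
Proof.
move=> ab acg dg.
pose h (t : R) : R := - C * t.
have ach : abs_cont_on a b h.
  apply: (@lipschitz_abs_cont_on _ _ `|C|) => // s t _ st _.
  by rewrite /h -mulrBr normrM normrN (ger0_norm (_ : 0 <= t - s))// subr_ge0.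
have dh (t : R) : is_derive t 1 h (- C).
  by rewrite -[- C]mulr1; exact: is_deriveZ.
have : (g \+ h) b <= (g \+ h) a.
  apply: abs_cont_derive1_le0_nincr => //; first exact: abs_cont_onD.
  apply: (lebesgue_ae_imply (p := 0)) dg => t _ dgt /dgt[dt1 dt2]; have [dh1 dh2] := dh t.
  split; first exact: derivableD.
  by move: dt2; rewrite !derive1E deriveD// dh2 subr_le0.
by rewrite /h /=; lra.
Qed.

Lemma abs_cont_derive1_norm_le a b g C : a <= b -> abs_cont_on a b g ->
  {ae @lebesgue_measure R, forall t, a <= t <= b ->
     derivable g t 1 /\ `|derive1 g t| <= C} ->
  `|g b - g a| <= C * (b - a).
Proof.
move=> ab acg dg; rewrite ler_norml lerNl; apply/andP; split.
  suff : (- g) b - (- g) a <= C * (b - a).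
    by rewrite -[(- g) b]/(- g b) -[(- g) a]/(- g a); lra.
  apply: abs_cont_derive1_le => //.
    move=> e e0; have [d [d0 hd]] := acg e e0; exists d; split=> // m s t st dis lt_d.
    apply: le_lt_trans (hd m s t st dis lt_d); apply: ler_sum => k _ /=.
    by rewrite -normrN opprD !opprK.
  apply: (lebesgue_ae_imply (p := 0)) dg => t _ dgt /dgt[d1 d2]; split; first exact: derivableN.
  by move: d2; rewrite !derive1E deriveN// ler_norml => /andP[]; lra.
apply: abs_cont_derive1_le => //.
apply: (lebesgue_ae_imply (p := 0)) dg => t _ dgt /dgt[d1 d2]; split=> //.
by move: d2; rewrite ler_norml => /andP[].
Qed.

Lemma abs_continuous_on_coord n a b (x : R -> 'cV[R]_n) i :
  abs_continuous_on a b x -> abs_cont_on a b (fun t => x t i 0).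
Proof.
move=> acx e e0; have [d [d0 hd]] := acx e e0; exists d; split=> // m s t st dis lt_d.
apply: le_lt_trans (hd m s t st dis lt_d); apply: ler_sum => k _ /=.
by have := coord_le_enorm (x (t k) - x (s k)) i; rewrite !mxE.
Qed.

Lemma lipschitz_abs_continuous_on n a b (x : R -> 'cV[R]_n) (C : 'I_n -> R) :
  (forall i, 0 <= C i) ->
  (forall s t i, a <= s -> s <= t -> t <= b ->
     `|x t i 0 - x s i 0| <= C i * (t - s)) ->
  abs_continuous_on a b x.
Proof.
move=> C0 lip e e0.
have C1 : 0 <= \sum_i C i by apply: sumr_ge0.
exists (e / (\sum_i C i + 1)); split; first by rewrite divr_gt0//; lra.
move=> m s t st _ lt_d.
apply: (@le_lt_trans _ _ ((\sum_i C i) * \sum_(k < m) (t k - s k))).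
  rewrite mulr_sumr; apply: ler_sum => k _; case/and3P: (st k) => *.
  apply: le_trans (enorm_le_sum _) _; rewrite mulr_suml; apply: ler_sum => i _.
  by rewrite !mxE; exact: lip.
have s0 : 0 <= \sum_(k < m) (t k - s k).
  by apply: sumr_ge0 => k _; case/and3P: (st k) => *; rewrite subr_ge0.
rewrite ltr_pdivlMr in lt_d; last lra.
by apply: le_lt_trans lt_d; rewrite mulrC; apply: ler_wpM2l => //; lra.
Qed.

Lemma derive1_coord n (x : R -> 'cV[R]_n) (t : R) i : derivable x t 1 ->
  is_derive t 1 (fun s => x s i 0) (derive1 x t i 0).
Proof.
move=> dx; apply: DeriveDef; first exact: (derivable_mxP _ _ _).1.
by rewrite derive1E derive_mx// mxE.
Qed.

End abs_cont.

Section unit_field_solution.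
Variables (R : realType) (n : nat) (A : 'M[R]_n.+1).
Variables (T : \bar R) (x : R -> 'cV[R]_n.+1).
Hypothesis solx : filippov_solution (unit_field A) T x.

(** Almost every velocity lies in the regularization, which inherits the uniform bound of the field,
    at the origin too. *)
Lemma solution_lipschitz s t i : 0 <= s -> s <= t -> (t%:E < T)%E ->
  `|x t i 0 - x s i 0| <= (\sum_j `|A i j|) * (t - s).
Proof.
move=> s0 st tT; have [_ acx aex] := solx.
apply: (@abs_cont_derive1_norm_le _ s t (fun u => x u i 0)) => //.
  apply: (@abs_cont_onS _ 0 t) => //; apply: abs_continuous_on_coord.
  by apply: acx => //; exact: le_trans st.
apply: (lebesgue_ae_imply (p := 0)) aex => u _ aeu /andP[su ut]; have [||dx Fx] := aeu.
- exact: le_trans su.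
- by apply: le_lt_trans tT; rewrite lee_fin.
have [dxi exi] := derive1_coord i dx; split => //.
by rewrite derive1E exi; exact: filippov_unit_field_bound Fx.
Qed.

End unit_field_solution.

(** * The Lyapunov function *)

Lemma is_derive_ord_sum (R : realType) (n : nat) (h : 'I_n -> R -> R) (t : R)
    (d : 'I_n -> R) :
  (forall i, is_derive t 1 (h i) (d i)) ->
  is_derive t 1 (fun s => \sum_(i < n) h i s) (\sum_(i < n) d i).
Proof.
move=> dh; rewrite (_ : (fun s => _) = \sum_(i < n) h i); last first.
  by apply/funext => s; rewrite fct_sumE.
exact: is_derive_sum.
Qed.

Section lyapunov.
Variables (R : realType) (n : nat) (A P : 'M[R]_n.+1) (k c : R).
Hypothesis Psym : P^T = P.
Hypothesis k0 : 0 < k.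
Hypothesis c0 : 0 < c.

Let V (y : 'cV[R]_n.+1) : R := (y^T *m P *m y) 0 0.

Hypothesis V_coercive : forall y, enorm y ^+ 2 <= k * V y.
(** The right-hand side is shaped so that dividing by [enorm y], as the field does, and by
    [Num.sqrt (V y)], as the derivative of the square root does, leaves the constant [- c]. *)
Hypothesis V_decrease : forall y,
  (y^T *m P *m (A *m y)) 0 0 <= - c * (enorm y * Num.sqrt (V y)).

Let V_ge0 y : 0 <= V y.
Proof. by rewrite -(pmulr_rge0 _ k0); apply: le_trans (V_coercive y); exact: sqr_ge0. Qed.

Let bilinear_sym (y z : 'cV[R]_n.+1) : (y^T *m P *m z) 0 0 = (z^T *m P *m y) 0 0.
Proof.
have -> : y^T *m P *m z = (z^T *m P *m y)^T by rewrite !trmx_mul trmxK Psym mulmxA.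
by rewrite mxE.
Qed.

(** The two terms of the product rule agree because [P] is symmetric. *)
Lemma is_derive_quadratic (x : R -> 'cV[R]_n.+1) (t : R) : derivable x t 1 ->
  is_derive t 1 (V \o x) (2 * ((x t)^T *m P *m derive1 x t) 0 0).
Proof.
move=> dx; have dxi i := derive1_coord i dx.
have -> : V \o x = fun s => \sum_j (\sum_i x s i 0 * P i j) * x s j 0.
  apply/funext => s; rewrite /V /= mxE; apply: eq_bigr => j _.
  by rewrite mxE; congr (_ * _); apply: eq_bigr => i _; rewrite mxE.
rewrite mulr_natl mulr2n {2}bilinear_sym.
rewrite [X in X + _]mxE [X in _ + X]mxE -big_split /=.
apply: is_derive_ord_sum => j.
rewrite mulrC [X in _ + X]mulrC [X in X + _]mulrC.
have dsum : is_derive t 1 (fun s => \sum_i x s i 0 * P i j)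
    (((derive1 x t)^T *m P) 0 j).
  rewrite mxE; apply: is_derive_ord_sum => i.
  rewrite mxE mulrC (_ : (fun s => _) = (P i j) *: (fun s => x s i 0)); last first.
    by apply/funext => s; rewrite mulrC.
  exact: is_deriveZ.
have := is_deriveM dsum (dxi j).
have -> : ((x t)^T *m P) 0 j = \sum_i x t i 0 * P i j.
  by rewrite mxE; apply: eq_bigr => i _; rewrite mxE.
by rewrite /GRing.scale /= [X in X + _]mulrC.
Qed.

Section along_a_solution.
Variables (T : \bar R) (x : R -> 'cV[R]_n.+1).
Hypothesis solx : filippov_solution (unit_field A) T x.

Let lip_const := \sum_i \sum_j `|A i j|.

Let lip_const_ge0 : 0 <= lip_const.
Proof. by apply: sumr_ge0 => i _; exact: sumr_ge0. Qed.

Lemma solution_enorm_lipschitz s t : 0 <= s -> s <= t -> (t%:E < T)%E ->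
  enorm (x t - x s) <= lip_const * (t - s).
Proof.
move=> s0 st tT; apply: le_trans (enorm_le_sum _) _.
rewrite mulr_suml; apply: ler_sum => i _; rewrite !mxE.
exact: solution_lipschitz tT.
Qed.

(** The difference of the two values is the form [P] paired between [x t - x s] and [x t + x s]. The
    first is bounded by the Lipschitz property, the second because the solution stays bounded on a
    compact interval. *)
Let abs_cont_V b : 0 <= b -> (b%:E < T)%E -> exists C, 0 <= C /\
  forall s t, 0 <= s -> s <= t -> t <= b -> `|V (x t) - V (x s)| <= C * (t - s).
Proof.
move=> b0 bT.
pose p := \sum_i \sum_j `|P i j|.
have p0 : 0 <= p by apply: sumr_ge0 => i _; exact: sumr_ge0.
pose B := \sum_i (`|x 0 i 0| + (\sum_j `|A i j|) * b).
have B0 : 0 <= B.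
  by apply: sumr_ge0 => i _; rewrite addr_ge0// mulr_ge0// sumr_ge0.
have xB t : 0 <= t -> t <= b -> enorm (x t) <= B.
  move=> t0 tb; apply: le_trans (enorm_le_sum _) _; apply: ler_sum => i _.
  have tT : (t%:E < T)%E by apply: le_lt_trans bT; rewrite lee_fin.
  have := solution_lipschitz solx i (lexx 0) t0 tT; rewrite subr0 => lip.
  rewrite -[x t i 0](subrK (x 0 i 0)); apply: le_trans (ler_normD _ _) _.
  rewrite addrC lerD2l; apply: le_trans lip _; apply: ler_wpM2l => //.
  exact: sumr_ge0.
exists (2 * p * B * lip_const); split; first by rewrite !mulr_ge0.
move=> s t s0 st tb; have t0 := le_trans s0 st; have sb := le_trans st tb.
have tT : (t%:E < T)%E by apply: le_lt_trans bT; rewrite lee_fin.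
have -> : V (x t) - V (x s) =
    ((x t - x s)^T *m P *m x t) 0 0 + ((x t - x s)^T *m P *m x s) 0 0.
  have subE (M1 M2 : 'M[R]_1) : (M1 - M2) 0 0 = M1 0 0 - M2 0 0 by rewrite !mxE.
  rewrite linearB /= !mulmxBl !subE (bilinear_sym (x s) (x t)) /V; ring.
apply: le_trans (ler_normD _ _) _.
have dE := solution_enorm_lipschitz s0 st tT.
have bnd y : enorm y <= B -> `|((x t - x s)^T *m P *m y) 0 0| <=
    p * (lip_const * (t - s) * B).
  move=> yB; apply: le_trans (bilinear_bound _ _ _) _.
  apply: ler_wpM2l => //; apply: ler_pM => //; exact: enorm_ge0.
have := bnd _ (xB t t0 tb); have := bnd _ (xB s s0 sb); lra.
Qed.

(** At the origin the velocity is not determined, but the left-hand side vanishes with [x t], and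
    the Boolean factor makes the right-hand side vanish too. *)
Let derive_V_le t : 0 <= t -> (t%:E < T)%E ->
  derivable x t 1 -> filippov (unit_field A) (x t) (derive1 x t) ->
  ((x t)^T *m P *m derive1 x t) 0 0 <= - c * (Num.sqrt (V (x t)) * (x t != 0)%:R).
Proof.
move=> t0 tT dx; have [->|xt0 Fx] := eqVneq (x t) 0.
  by rewrite trmx0 !mul0mx mxE mulr0 mulr0.
rewrite (filippov_unit_field_neq0 xt0 Fx) /unit_field -scalemxAr mxE.
have e0 := enorm_gt0 xt0; rewrite ler_pdivrMl// mulr1 mulrCA.
exact: V_decrease.
Qed.

Lemma solution_V_nincr s t : 0 <= s -> s <= t -> (t%:E < T)%E ->
  V (x t) <= V (x s).
Proof.
move=> s0 st tT; have t0 := le_trans s0 st.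
have [C [C0 lipC]] := abs_cont_V t0 tT; have [_ _ aex] := solx.
apply: (@abs_cont_derive1_le0_nincr _ s t (V \o x)) => //.
  apply: (@lipschitz_abs_cont_on _ _ _ C) => // u v su uv vt.
  by apply: lipC => //; exact: le_trans su.
apply: (lebesgue_ae_imply (p := 0)) aex => u _ aeu /andP[su ut].
have u0 := le_trans s0 su.
have uT : (u%:E < T)%E by apply: le_lt_trans tT; rewrite lee_fin.
have [dx Fx] := aeu u0 uT; have [dV eV] := is_derive_quadratic dx; split => //.
rewrite derive1E eV mulr_ge0_le0//; apply: le_trans (derive_V_le u0 uT dx Fx) _.
by rewrite mulNr oppr_le0 !mulr_ge0 ?sqrtr_ge0// ltW.
Qed.

(** The square root is singular at 0, but by monotonicity [V] stays above [V (x b) > 0] on the whole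
    interval; there the chain rule gives slope at most [- c]. *)
Lemma solution_sqrtV_decrease b : 0 <= b -> (b%:E < T)%E -> 0 < V (x b) ->
  Num.sqrt (V (x b)) <= Num.sqrt (V (x 0)) - c * b.
Proof.
move=> b0 bT Vb; have [_ _ aex] := solx; set v := V (x b) in Vb *.
have vV t : 0 <= t -> t <= b -> v <= V (x t) by move=> t0 tb; exact: solution_V_nincr.
have sv : 0 < Num.sqrt v by rewrite sqrtr_gt0.
have [C [C0 lipC]] := abs_cont_V b0 bT.
suff : Num.sqrt (V (x b)) - Num.sqrt (V (x 0)) <= - c * (b - 0) by rewrite subr0 -/v; lra.
apply: (@abs_cont_derive1_le _ 0 b (Num.sqrt \o (V \o x))) => //.
  (* The constant comes from the difference of two squares: the sum of the two square roots is at
     least [Num.sqrt v]. *)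
  apply: (@lipschitz_abs_cont_on _ _ _ (C / Num.sqrt v)); first by rewrite divr_ge0// ltW.
  move=> s t s0 st tb; rewrite /= mulrAC ler_pdivlMr//.
  apply: le_trans (lipC s t s0 st tb).
  have := vV t (le_trans s0 st) tb; have := vV s s0 (le_trans st tb) => vs vt.
  rewrite -{2}(sqr_sqrtr (V_ge0 (x t))) -{2}(sqr_sqrtr (V_ge0 (x s))) subr_sqr normrM.
  apply: ler_wpM2l => //; rewrite ger0_norm ?addr_ge0 ?sqrtr_ge0//.
  apply: (@le_trans _ _ (Num.sqrt (V (x t)))); first exact: ler_wsqrtr.
  by rewrite lerDl sqrtr_ge0.
apply: (lebesgue_ae_imply (p := 0)) aex => u _ aeu /andP[u0 ub].
have uT : (u%:E < T)%E by apply: le_lt_trans bT; rewrite lee_fin.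
have [dx Fx] := aeu u0 uT; have dV := is_derive_quadratic dx.
have Vu : 0 < V (x u) by apply: lt_le_trans (vV u u0 ub).
have [dS eS] := is_derive1_comp (is_derive1_sqrt Vu) dV; split => //.
rewrite derive1E eS invfM mulrCA -mulrA mulVKf// ler_pdivrMl ?sqrtr_gt0//.
apply: le_trans (derive_V_le u0 uT dx Fx) _.
have -> : x u != 0 by apply: contraTneq Vu => ->; rewrite /V trmx0 !mul0mx mxE ltxx.
by rewrite mulr1 mulrC.
Qed.

Lemma solution_enorm_bound t : 0 <= t -> (t%:E < T)%E ->
  enorm (x t) ^+ 2 <= k * (\sum_i \sum_j `|P i j|) * enorm (x 0) ^+ 2.
Proof.
move=> t0 tT; apply: le_trans (V_coercive _) _; rewrite -mulrA.
apply: ler_wpM2l; first exact: ltW.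
apply: le_trans (solution_V_nincr (lexx 0) t0 tT) _.
by rewrite expr2; apply: le_trans (ler_norm _) (bilinear_bound _ _ _).
Qed.

(** Past this time the linear decrease would make [Num.sqrt (V (x t))] negative, unless [V (x t)] is
    0. *)
Lemma solution_eq0 t : Num.sqrt (V (x 0)) / c < t -> (t%:E < T)%E -> x t = 0.
Proof.
move=> ct tT.
have t0 : 0 <= t by apply: ltW; apply: le_lt_trans ct; rewrite divr_ge0 ?sqrtr_ge0// ltW.
have Vt : V (x t) = 0.
  apply/le_anti; rewrite V_ge0 andbT leNgt; apply/negP => Vt.
  have := solution_sqrtV_decrease t0 tT Vt; have := sqrtr_ge0 (V (x t)).
  by rewrite ltr_pdivrMr// in ct; lra.
apply: enorm_eq0; apply/eqP; rewrite -sqrf_eq0; apply/eqP/le_anti.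
by rewrite sqr_ge0 andbT; apply: le_trans (V_coercive _) _; rewrite Vt mulr0.
Qed.

End along_a_solution.

Lemma unit_field_lyapunov_stable : lyapunov_stable (unit_field A).
Proof.
move=> e e0; pose q := k * \sum_i \sum_j `|P i j|.
have q0 : 0 <= q by rewrite mulr_ge0 ?(ltW k0)// sumr_ge0// => i _; exact: sumr_ge0.
(* Since [q] is at most [(q + 1) ^+ 2], this choice avoids a square root of [q]. *)
exists (e / (q + 1)); split; first by rewrite divr_gt0//; lra.
move=> T x solx x0 t t0 tT.
rewrite -(ltr_pXn2r (_ : 0 < 2)%N) ?nnegrE ?enorm_ge0 ?(ltW e0)//.
apply: le_lt_trans (solution_enorm_bound solx t0 tT) _; rewrite -/q.
rewrite ltr_pdivlMr in x0; last lra.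
apply: (@le_lt_trans _ _ ((enorm (x 0) * (q + 1)) ^+ 2)).
  rewrite exprMn mulrC; apply: ler_wpM2l; first exact: sqr_ge0.
  have := mulr_ge0 q0 q0; rewrite sqrrD expr1n mulr1 expr2; lra.
by rewrite ltr_pXn2r ?nnegrE ?mulr_ge0 ?enorm_ge0 ?(ltW e0)//; lra.
Qed.

End lyapunov.

(** * Continuation of solutions *)

Section extension.
Variables (R : realType) (n : nat) (A : 'M[R]_n.+1).

Let C (i : 'I_n.+1) := \sum_j `|A i j|.

Let C_ge0 i : 0 <= C i. Proof. exact: sumr_ge0. Qed.

(* McShane's formula gives the limit as an infimum. *)
Lemma solution_limit (r : R) (x : R -> 'cV[R]_n.+1) :
  filippov_solution (unit_field A) r%:E x ->
  exists z : 'cV[R]_n.+1, forall i s, 0 <= s -> s < r ->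
    `|z i 0 - x s i 0| <= C i * (r - s).
Proof.
move=> solx; have [r0 _ _] := solx; rewrite lte_fin in r0.
pose S i := [set v | exists s, [/\ 0 <= s, s < r & v = x s i 0 + C i * (r - s)]].
exists (\col_i inf (S i)) => i s s0 sr; rewrite mxE.
have lb : lbound (S i) (x s i 0 - C i * (r - s)).
  move=> _ [u [u0 ur ->]]; have [su|us] := leP s u.
    have := solution_lipschitz solx i s0 su ur; rewrite -/(C i) ler_norml => /andP[].
    have : 0 <= C i * (r - u) by rewrite mulr_ge0// subr_ge0 ltW.
    lra.
  have := solution_lipschitz solx i u0 (ltW us) sr; rewrite -/(C i) ler_norml => /andP[_].
  have : 0 <= C i * (r - s) by rewrite mulr_ge0// subr_ge0 ltW.
  lra.
have Sx : S i (x s i 0 + C i * (r - s)) by exists s.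
have := ge_inf (ex_intro _ _ lb) Sx; have := lb_le_inf (ex_intro _ _ Sx) lb.
by rewrite ler_norml; lra.
Qed.

Variables (r h : R) (x w : R -> 'cV[R]_n.+1).
Hypothesis solx : filippov_solution (unit_field A) r%:E x.
Hypothesis h0 : 0 < h.
Hypothesis w0 : forall i s, 0 <= s -> s < r -> `|w 0 i 0 - x s i 0| <= C i * (r - s).
Hypothesis dw : forall t, 0 <= t < h -> forall i,
  is_derive t 1 (fun s => w s i 0) (unit_field A (w t) i 0).

Let w_lipschitz s t i : 0 <= s -> s <= t -> t < h ->
  `|w t i 0 - w s i 0| <= C i * (t - s).
Proof.
move=> s0 st th.
have [||u] := @MVT_segment R (fun s => w s i 0) (fun s => unit_field A (w s) i 0) s t st.
- by move=> u; rewrite in_itv /= => /andP[su ut]; apply: dw; lra.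
- apply: derivable_within_continuous => u; rewrite in_itv /= => /andP[su ut].
  by case: (dw (t := u) ltac:(lra) i).
- move=> _ ->; rewrite normrM (ger0_norm (_ : 0 <= t - s)) ?subr_ge0//.
  by apply: ler_wpM2r; [rewrite subr_ge0|exact: unit_field_bound].
Qed.

Definition glue (t : R) : 'cV[R]_n.+1 := if t < r then x t else w (t - r).

(** Both pieces have Lipschitz constant [C i], and across the seam the two estimates add up with the
    same constant because [w] starts at the limit of [x]. The derivatives need not match at [r], a
    single point. *)
Lemma glue_solution : filippov_solution (unit_field A) (r + h)%:E glue.
Proof.
have [r0 _ aex] := solx; rewrite lte_fin in r0.
split; first by rewrite lte_fin addr_gt0.
  move=> b b0; rewrite lte_fin => bT.
  apply: (@lipschitz_abs_continuous_on _ _ _ _ _ C) => // s t i s0 st tb.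
  rewrite /glue; case: (ltP t r) => tr.
    by rewrite (le_lt_trans st tr); exact: (solution_lipschitz solx).
  case: (ltP s r) => sr.
    have := w_lipschitz (s := 0) (t := t - r) i (lexx _) ltac:(lra) ltac:(lra).
    have := w0 i s0 sr; rewrite subr0 => h1 h2.
    rewrite -(subrK (w 0 i 0) (w (t - r) i 0)) -addrA.
    apply: le_trans (ler_normD _ _) _.
    have -> : t - s = (t - r) + (r - s) by ring.
    by rewrite mulrDr lerD.
  have := w_lipschitz (s := s - r) (t := t - r) i ltac:(lra) ltac:(lra) ltac:(lra).
  by rewrite (_ : t - r - (s - r) = t - s) //; ring.
apply: (lebesgue_ae_imply (p := r)) aex => t tr aet t0; rewrite lte_fin => tT.
have [{}tr|{}tr|/eqP] := ltgtP t r; last by rewrite (negbTE tr).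
  have near_t : \forall s \near t, x s = glue s.
    have : \forall s \near t, s < r by exact: lt_nbhsl.
    by apply: filterS => s sr; rewrite /glue sr.
  have [|dx Fx] := aet t0; first by rewrite lte_fin.
  split; first exact: near_eq_derivable near_t dx.
  by rewrite derive1E -(near_eq_derive _ near_t) -derive1E /glue tr.
have near_t : \forall s \near t, w (s - r) = glue s.
  have : \forall s \near t, r < s by exact: lt_nbhsr.
  by apply: filterS => s sr; rewrite /glue ltNge (ltW sr).
have dwi i : is_derive t 1 (fun s => w (s - r) i 0) (unit_field A (w (t - r)) i 0).
  have shift : is_derive t 1 (fun s : R => s - r) 1.
    rewrite -[X in is_derive _ _ _ X]subr0; exact: is_deriveB.
  rewrite -[X in is_derive _ _ _ X]mulr1.
  apply: (@is_derive1_comp _ (fun s => w s i 0) (fun s => s - r)) => //.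
  by apply: dw; lra.
have dwt : derivable (fun s => w (s - r)) t 1.
  by apply/derivable_mxP => i j; rewrite ord1; case: (dwi i).
split; first exact: near_eq_derivable near_t dwt.
rewrite derive1E -(near_eq_derive _ near_t) derive_mx// -(nbhs_singleton near_t).
rewrite (_ : \matrix_(_, _) _ = unit_field A (w (t - r))).
  exact: filippov_unit_field_mem.
by apply/matrixP => i j; rewrite mxE ord1; case: (dwi i).
Qed.

End extension.

Lemma maximal_solution_infinite (R : realType) (n : nat) (A : 'M[R]_n.+1)
    (T : \bar R) (x : R -> 'cV[R]_n.+1) :
  maximal_filippov_solution (unit_field A) T x -> T = +oo%E.
Proof.
case: T => [r||] [solx maxx] //; last by case: solx.
have [z zlim] := solution_limit solx.
have [h [w [h0 w0 dw]]] : exists (h : R) (w : R -> 'cV[R]_n.+1),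
    [/\ 0 < h, w 0 = z & forall t, 0 <= t < h -> forall i,
     is_derive t 1 (fun s => w s i 0) (unit_field A (w t) i 0)].
  (* From the origin the constant 0 is a continuation, as the field vanishes there. *)
  have [->|] := eqVneq z 0; last exact: unit_field_local_solution.
  exists 1, (fun=> 0); split => // t _ i.
  by rewrite /unit_field mulmx0 scaler0 mxE; exact: is_derive_cst.
rewrite -w0 in zlim.
have := maxx _ _ (glue_solution solx h0 zlim dw); rewrite lee_fin lerDl (ltW h0).
move=> /(_ isT) eqT; have [] : (r + h)%:E = r%:E; last by move=> eq_r; exfalso; lra.
by apply: eqT => t t0; rewrite lte_fin /glue => ->.
Qed.

(** * The linear matrix inequality *)

Section posdef.
Variables (R : realType) (n : nat) (X : 'M[R]_n).
Hypothesis posX : posdef X.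
Implicit Types v : 'cV[R]_n.

Lemma posdef_ge0 v : 0 <= (v^T *m X *m v) 0 0.
Proof.
have [->|v0] := eqVneq v 0; first by rewrite mulmx0 mxE.
by apply: ltW; exact: posX.2.
Qed.

Lemma posdef_unitmx : X \in unitmx.
Proof.
rewrite -row_free_unit -kermx_eq0; apply/rowV0P => v /sub_kermxP vX.
apply/eqP/negPn/negP => v0; have := posX.2 v^T.
by rewrite trmxK vX mul0mx mxE ltxx => /(_ _)/negP; apply; rewrite // trmx_eq0.
Qed.

Lemma posdef_diag_gt0 i : 0 < X i i.
Proof.
have := posX.2 (delta_mx i 0); rewrite trmx_delta -rowE -colE !mxE; apply.
by apply/eqP => /matrixP/(_ i 0)/eqP; rewrite !mxE !eqxx oner_eq0.
Qed.

(* Cauchy-Schwarz for the form X, with the vectors v and e_i. *)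
Lemma posdef_sqr_coord_le v i :
  (X *m v) i 0 ^+ 2 <= X i i * (v^T *m X *m v) 0 0.
Proof.
have Xii := posdef_diag_gt0 i; set q := (X *m v) i 0.
pose e : 'cV[R]_n := delta_mx i 0.
have eXe : (e^T *m X *m e) 0 0 = X i i by rewrite trmx_delta -rowE -colE !mxE.
have eXv : (e^T *m X *m v) 0 0 = q by rewrite -mulmxA trmx_delta -rowE mxE.
have vXe : (v^T *m X *m e) 0 0 = q.
  have -> : v^T *m X *m e = (e^T *m X *m v)^T by rewrite !trmx_mul trmxK posX.1 mulmxA.
  by rewrite mxE.
(* This coefficient minimizes the form on the line through [v] in the direction [e]; the minimum is
   $v^\top Xv-q^2/X_{ii}$. *)
have := posdef_ge0 (v - (q / X i i) *: e).
have subE (M1 M2 : 'M[R]_1) : (M1 - M2) 0 0 = M1 0 0 - M2 0 0 by rewrite !mxE.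
have -> : (v - (q / X i i) *: e)^T = v^T - (q / X i i) *: e^T by rewrite linearB linearZ.
rewrite !mulmxBl !mulmxBr -!scalemxAl -!scalemxAr !subE.
have scE (a : R) (M1 : 'M[R]_1) : (a *: M1) 0 0 = a * M1 0 0 by rewrite mxE.
rewrite !scE eXe eXv vXe divfK ?gt_eqF// => H.
rewrite mulrC -ler_pdivrMr// expr2 mulrAC; lra.
Qed.

(** The trace stands for an upper bound of the largest eigenvalue. With $v=X^{-1}x$ this becomes the
    coercivity of the Lyapunov function. *)
Lemma posdef_enorm_le v :
  enorm (X *m v) ^+ 2 <= \tr X * (v^T *m X *m v) 0 0.
Proof.
by rewrite sqr_enorm mulr_suml; apply: ler_sum => i _; exact: posdef_sqr_coord_le.
Qed.

End posdef.

(** The vectors with second half 0 isolate the upper left block. Its first two terms give equal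
    quadratic forms, whence [mu / 4] is halved, and the form of [M] is nonnegative. The bound at the
    vertices is then averaged with the weights [alpha]. *)
Lemma LMI_decrease (R : realType) (n N : nat) (H : 'I_N -> 'M[R]_n) (mu : R)
    (M L : 'M[R]_n) (alpha : 'I_N -> R) (v : 'cV[R]_n) :
  posdef M ->
  (forall i : 'I_N,
      negdef (block_mx
        (H i *m L + L^T *m (H i)^T + (mu / 4)%:M + M) (L^T *m (H i)^T)
        (H i *m L)                                    (- mu%:M))) ->
  unit_simplex alpha ->
  (v^T *m (polytope_mx H alpha *m L) *m v) 0 0 <= - (mu / 8) * enorm v ^+ 2.
Proof.
move=> posM LMI [alpha1 alpha0].
have vertex i : (v^T *m (H i *m L) *m v) 0 0 <= - (mu / 8) * enorm v ^+ 2.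
  have [->|v0] := eqVneq v 0; first by rewrite mulmx0 mxE enorm0 expr0n mulr0.
  have := (LMI i).2 (col_mx v 0); rewrite col_mx_eq0 (negbTE v0) => /(_ isT).
  rewrite tr_col_mx trmx0 mul_row_block !mul0mx !addr0 mul_row_col mulmx0 addr0.
  have addE (M1 M2 : 'M[R]_1) : (M1 + M2) 0 0 = M1 0 0 + M2 0 0 by rewrite mxE.
  rewrite !mulmxDr !mulmxDl !addE.
  have -> : (v^T *m (L^T *m (H i)^T) *m v) 0 0 = (v^T *m (H i *m L) *m v) 0 0.
    rewrite -trmx_mul (_ : _ *m _ *m v = (v^T *m (H i *m L) *m v)^T) ?mxE//.
    by rewrite !trmx_mul trmxK !mulmxA.
  have -> : (v^T *m (mu / 4)%:M *m v) 0 0 = mu / 4 * enorm v ^+ 2.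
    rewrite mul_mx_scalar -scalemxAl mxE sqr_enorm mxE; congr (_ * _).
    by apply: eq_bigr => j _; rewrite mxE expr2.
  have := posdef_ge0 posM v; lra.
rewrite /polytope_mx mulmx_suml mulmx_sumr mulmx_suml summxE.
rewrite -[leRHS]mul1r -[X in X * _]alpha1 mulr_suml; apply: ler_sum => i _.
have -> : v^T *m (alpha i *: H i *m L) *m v = alpha i *: (v^T *m (H i *m L) *m v).
  by rewrite -scalemxAl -scalemxAr -scalemxAl.
by rewrite mxE; apply: ler_wpM2l.
Qed.

Theorem theorem1 (R : realType) (n N : nat) (hn : (0 < n)%N) (hN : (0 < N)%N)
    (H : 'I_N -> 'M[R]_n) (omega mu : R) (homega : 0 < omega) (hmu : 0 < mu)
    (X M L : 'M[R]_n) (hXsym : X^T = X) (hMsym : M^T = M)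
    (hX : posdef X) (hM : posdef M)
    (hLMI : forall i : 'I_N,
      negdef (block_mx
        (H i *m L + L^T *m (H i)^T + (mu / 4)%:M + M) (L^T *m (H i)^T)
        (H i *m L)                                    (- mu%:M)))
    (alpha : 'I_N -> R) (halpha : unit_simplex alpha) :
  finite_time_stable
    (closed_loop omega (polytope_mx H alpha) (L *m invmx X)).
Proof.
case: n hn H X M L hXsym hMsym hX hM hLMI => // n _ H X M L hXsym _ hX hM hLMI.
set Ha := polytope_mx H alpha.
pose A := omega^-1 *: (Ha *m (L *m invmx X)).
have -> : closed_loop omega Ha (L *m invmx X) = unit_field A.
  apply/funext => x; rewrite /closed_loop /unit_field /A.
  by rewrite -scalemxAr -scalemxAl !scalerA mulrC.
have uX := posdef_unitmx hX.
pose P := invmx X.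
have Psym : P^T = P by rewrite /P trmx_inv hXsym.
pose V (y : 'cV[R]_n.+1) := (y^T *m P *m y) 0 0.
have VE (x : 'cV[R]_n.+1) : V x = ((P *m x)^T *m X *m (P *m x)) 0 0.
  by rewrite /V trmx_mul Psym -(mulmxA x^T P X) mulVmx// mulmx1 mulmxA.
have XP (x : 'cV[R]_n.+1) : X *m (P *m x) = x by rewrite mulmxA mulmxV// mul1mx.
have V0 x : 0 <= V x by rewrite VE; exact: posdef_ge0.
pose k := \tr X.
have k0 : 0 < k.
  rewrite /k /mxtrace big_ord_recl ltr_wpDr ?posdef_diag_gt0//.
  by apply: sumr_ge0 => i _; rewrite ltW ?posdef_diag_gt0.
have coercive x : enorm x ^+ 2 <= k * V x.
  by rewrite VE -{1}(XP x); exact: posdef_enorm_le.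
pose p := \sum_i \sum_j `|X i j|.
have p0 : 0 <= p by apply: sumr_ge0 => i _; exact: sumr_ge0.
have Vle x : V x <= p * enorm (P *m x) ^+ 2.
  by rewrite VE expr2; apply: le_trans (ler_norm _) (bilinear_bound _ _ _).
(* With $y=Px$ one has $\|x\|\le\sqrt{kV}$ and $V\le p\|y\|^2$, hence $\|x\|\sqrt V\le q\|y\|^2$;
   the added 1 makes [q] positive. *)
pose q := Num.sqrt k * p + 1.
have q0 : 0 < q by rewrite ltr_wpDl// mulr_ge0// sqrtr_ge0.
pose c := omega^-1 * (mu / 8) / q.
have c0 : 0 < c by rewrite !divr_gt0// mulr_gt0 ?invr_gt0// divr_gt0.
have decrease x : (x^T *m P *m (A *m x)) 0 0 <= - c * (enorm x * Num.sqrt (V x)).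
  (* As the gain is [L *m P], it sends [x] to [L *m (P *m x)], so the form is the one that the
     matrix inequality controls. *)
  have -> : (x^T *m P *m (A *m x)) 0 0 =
      omega^-1 * ((P *m x)^T *m (Ha *m L) *m (P *m x)) 0 0.
    by rewrite trmx_mul Psym /A -scalemxAl -scalemxAr mxE !mulmxA.
  have d := LMI_decrease (P *m x) hM hLMI halpha.
  apply: (@le_trans _ _ (omega^-1 * (- (mu / 8) * enorm (P *m x) ^+ 2))).
    by apply: ler_wpM2l d; rewrite invr_ge0 ltW.
  rewrite !mulNr mulrN lerN2 [leRHS]mulrA /c -[leLHS]mulrA; apply: ler_wpM2l.
    by rewrite mulr_ge0 ?invr_ge0 ?divr_ge0 ?ltW.
  rewrite ler_pdivrMl//.
  have ex : enorm x <= Num.sqrt k * Num.sqrt (V x).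
    rewrite -(ler_pXn2r (_ : 0 < 2)%N) ?nnegrE ?mulr_ge0 ?sqrtr_ge0 ?enorm_ge0//.
    by rewrite exprMn [in leRHS]sqr_sqrtr ?(ltW k0)// [in leRHS]sqr_sqrtr.
  apply: (@le_trans _ _ (Num.sqrt k * V x)).
    rewrite -[in leRHS](sqr_sqrtr (V0 x)) expr2 mulrA.
    by apply: ler_wpM2r => //; exact: sqrtr_ge0.
  apply: (@le_trans _ _ (Num.sqrt k * (p * enorm (P *m x) ^+ 2))).
    by apply: ler_wpM2l; [exact: sqrtr_ge0|exact: Vle].
  by rewrite mulrA; apply: ler_wpM2r; [exact: sqr_ge0|rewrite /q lerDl].
split; first exact: (unit_field_lyapunov_stable Psym k0 c0 coercive decrease).
move=> T x maxx; have Too := maximal_solution_infinite maxx; split => //.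
have [solx _] := maxx; have sc : 0 <= Num.sqrt (V (x 0)) / c.
  by rewrite divr_ge0 ?sqrtr_ge0 ?ltW.
(* The added 1 supplies the strict inequality in [solution_eq0]. *)
exists (Num.sqrt (V (x 0)) / c + 1); split; first by lra.
move=> t tt; apply: (solution_eq0 Psym k0 c0 coercive decrease solx).
  by rewrite -/(V _); lra.
by rewrite Too ltry.
Qed.
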